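(* In the known-positions setting, there is no deterministic strategyproof mechanism with approximation ratio smaller than $13/11$.
   Context: Setting: a finite nonempty set $N$ of $n$ agents and two facilities $1,2$. Agent $i$ has a position $x_i\in[0,1]$ and an approval preference $t_i=(t_{i1},t_{i2})\in\{0,1\}^2$ ($t_{ij}=1$ iff $i$ approves facility $j$); every agent approves at least one facility. An instance is $I=(\mathbf{x},\mathbf{t})$. If facility $j$ is located at $y\in[0,1]$ (a single facility is located), agent $i$ has utility $u_i(j,y|I)=t_{ij}(1-|x_i-y|)$; the social welfare is $W(j,y|I)=\sum_{i\in N}u_i(j,y|I)$ and $W^*(I)=\max_{(j,y)}W(j,y|I)$. A deterministic mechanism $M$ maps each instance $I$ to an outcome $M(I)=(j,y)\in\{1,2\}\times[0,1]$. Its approximation ratio is $\rho(M)=\sup_I W^*(I)/W(M(I)|I)$ over all instances (with any number of agents). In the known-positions setting positions are public and agents can misreport only preferences: $M$ is strategyproof if for every instance $I=(\mathbf{x},\mathbf{t})$, agent $i$ and alternative preference $t_i'$, with $I'=(\mathbf{x},(t_i',\mathbf{t}_{-i}))$, we have $u_i(M(I)|I)\ge u_i(M(I')|I)$. *)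

(* Defs.v *)
From mathcomp Require Import all_boot all_order all_algebra.
From mathcomp Require Import all_classical all_reals all_analysis.
Set Implicit Arguments.
Unset Strict Implicit.
Unset Printing Implicit Defensive.
Import Order.TTheory GRing.Theory Num.Theory.
Import numFieldNormedType.Exports.
Local Open Scope classical_set_scope.
Local Open Scope ring_scope.

Definition facility := 'I_2.

Definition preference := {t : {ffun facility -> bool} | [exists j, t j]}.

(* The index [n] stands for [n.+1] agents, so that every instance has a
   nonempty set of agents. *)
Record instance (R : realType) (n : nat) := Instance {
  position : {ffun 'I_n.+1 -> {i01 R}} ;
  approval : {ffun 'I_n.+1 -> preference} }.

Definition outcome (R : realType) : Type := (facility * {i01 R})%type.

Definition utility (R : realType) (n : nat) (I : instance R n)
    (i : 'I_n.+1) (o : outcome R) : R :=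
  (val (approval I i) o.1)%:R * (1 - `|(position I i)%:num - o.2%:num|).

Definition welfare (R : realType) (n : nat) (I : instance R n)
    (o : outcome R) : R :=
  \sum_(i < n.+1) utility I i o.

Definition opt_welfare (R : realType) (n : nat) (I : instance R n) : R :=
  sup (range (welfare I)).

Definition misreport (R : realType) (n : nat) (I : instance R n)
    (i : 'I_n.+1) (t' : preference) : instance R n :=
  Instance (position I) [ffun k => if k == i then t' else approval I k].

Definition mechanism (R : realType) : Type :=
  forall n : nat, instance R n -> outcome R.

Definition strategyproof (R : realType) (M : mechanism R) : Prop :=
  forall (n : nat) (I : instance R n) (i : 'I_n.+1) (t' : preference),
    utility I i (M n (misreport I i t')) <= utility I i (M n I).

(* The quotient is taken in the extended reals, where [x / 0 = +oo] for
   [0 < x]; see [opt_welfare_gt0] for the positivity of the numerator. *)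
Definition approx_ratio (R : realType) (M : mechanism R) : \bar R :=
  ereal_sup [set r | exists (n : nat) (I : instance R n),
    r = ((opt_welfare I)%:E / (welfare I (M n I))%:E)%E].

Lemma welfare_max_ex (R : realType) (n : nat) (I : instance R n) :
  exists o : outcome R, forall o', welfare I o' <= welfare I o.
Proof.
pose f (j : facility) (y : R) : R := \sum_(i < n.+1)
  (val (approval I i) j)%:R * (1 - `|(position I i)%:num - y|).
have max_f (j : facility) :
    exists y : {i01 R}, forall z : {i01 R}, welfare I (j, z) <= welfare I (j, y).
  have [||c cI cmax] := @EVT_max R (f j) 0 1.
  - exact: ler01.
  - apply: continuous_subspaceT => y.
    apply: cvg_big => [|i _]; first exact: add_continuous.
    apply: cvgM; first exact: cvg_cst.
    apply: cvgB; first exact: cvg_cst.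
    apply: cvg_norm; apply: cvgB; first exact: cvg_cst.
    exact: cvg_id.
  have cP : Itv.spec (@Itv.num_sem R) (Itv.Real `[0%Z, 1%Z]) c.
    rewrite /= /Itv.num_sem /=; move: cI; rewrite !in_itv /= => /andP[c0 c1].
    by rewrite ger0_real //= c0 c1.
  exists (Itv.mk cP) => z.
  by apply: (cmax z%:num); rewrite in_itv /=; apply/andP; split.
have [y0 y0max] := max_f ord0; have [y1 y1max] := max_f (lift ord0 ord0).
have jE (j : facility) : j = ord0 \/ j = lift ord0 ord0.
  by case: (unliftP ord0 j) => [k|] ->; [right; rewrite (ord1 k) | left].
have [le10|/ltW le01] :=
    leP (welfare I (lift ord0 ord0, y1)) (welfare I (ord0, y0)).
- exists (ord0, y0) => -[j z]; case: (jE j) => ->; first exact: y0max.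
  exact: le_trans (y1max z) le10.
- exists (lift ord0 ord0, y1) => -[j z]; case: (jE j) => ->; last exact: y1max.
  exact: le_trans (y0max z) le01.
Qed.

Lemma opt_welfare_max (R : realType) (n : nat) (I : instance R n) :
  (exists o, opt_welfare I = welfare I o) /\
  (forall o, welfare I o <= opt_welfare I).
Proof.
have [w wmax] := welfare_max_ex I.
have ubo : ubound (range (welfare I)) (welfare I w) by move=> _ [p _ <-].
have lesup o' : welfare I o' <= opt_welfare I.
  by apply: ub_le_sup; [exists (welfare I w) | exists o'].
split=> //; exists w; apply/le_anti; rewrite lesup andbT.
by apply: ge_sup => //; exists (welfare I w), w.
Qed.

Lemma utility_ge0 (R : realType) (n : nat) (I : instance R n) i o :
  0 <= utility I i o.
Proof.
apply: mulr_ge0 => //; rewrite subr_ge0.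
rewrite ler_norml; apply/andP; split.
- have : o.2%:num <= 1 by [].
  have : 0 <= (position I i)%:num by [].
  by move=> h1 h2; rewrite lerBrDr addrC; apply: le_trans h1; rewrite subr_le0.
- have : 0 <= o.2%:num by [].
  have : (position I i)%:num <= 1 by [].
  by move=> h1 h2; rewrite lerBlDr; apply: le_trans h1 _; rewrite lerDl.
Qed.

Lemma opt_welfare_gt0 (R : realType) (n : nat) (I : instance R n) :
  0 < opt_welfare I.
Proof.
have [j tj] := existsP (valP (approval I ord0)).
have [_ /(_ (j, position I ord0))] := opt_welfare_max I.
apply: lt_le_trans; rewrite /welfare big_ord_recl /=.
rewrite ltr_pwDl ?sumr_ge0 // => [|i _]; last exact: utility_ge0.
by rewrite /utility /= tj subrr normr0 subr0 mulr1.
Qed.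

(* Main.v *)
(* Two agents at 0 approve only facility 0 and two agents at 3/5 approve only
   facility 1.  By symmetry the mechanism opens the facility [j] of, say, the
   agents at 0, and a ratio below 13/11 forces it within distance 2/13 of them.
   Now let one of these two agents approve both facilities.  The other facility
   at 3/5 then has welfare 12/5, whereas [j] has welfare at most 2, so the other
   facility must be opened; but strategyproofness keeps it within 2/13 of the
   agent that changed its report, where its welfare is at most 9/5 + 2/13. *)
Require Import Defs.
From mathcomp Require Import all_boot all_order all_algebra.
From mathcomp Require Import all_classical all_reals all_analysis.
From mathcomp Require Import ring lra.
Set Implicit Arguments.
Unset Strict Implicit.
Unset Printing Implicit Defensive.
Import Order.TTheory GRing.Theory Num.Theory.
Local Open Scope ring_scope.

(** Clears the supremum and the extended-real quotient, leaving linear inequalities over [R]. *)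
Lemma approx_ratio_welfare_lt (R : realType) (M : mechanism R) (c : R) :
  (approx_ratio M < c%:E)%E ->
  forall n (I : instance R n) o, welfare I o < c * welfare I (M n I).
Proof.
move=> Mc n I o; have [_ /(_ o) /le_lt_trans] := opt_welfare_max I; apply.
have : ((opt_welfare I)%:E / (welfare I (M n I))%:E < c%:E)%E.
  by apply: le_lt_trans Mc; apply: ereal_sup_ubound; exists n, I.
(* Zero welfare would make the quotient [+oo], since the optimum is positive. *)
have [w0|w0] := eqVneq (welfare I (M n I)) 0.
  by rewrite w0 inve0 gt0_muley ?lte_fin ?opt_welfare_gt0.
have wgt0 : 0 < welfare I (M n I).
  by rewrite lt_neqAle eq_sym w0 sumr_ge0 // => i _; apply: utility_ge0.
by rewrite inver (negbTE w0) -EFinM lte_fin ltr_pdivrMr.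
Qed.

Lemma misreportK (R : realType) (n : nat) (I : instance R n) i t' :
  misreport (misreport I i t') i (approval I i) = I.
Proof.
case: I => x t; rewrite /misreport /=; congr Instance.
by apply/ffunP => k; rewrite !ffunE; case: eqP => [->|].
Qed.

(** Here the misreported preference counts as the true one, and the deviation goes back to [I]. *)
Lemma strategyproof_misreport (R : realType) (M : mechanism R) n
    (I : instance R n) i t' : strategyproof M ->
  utility (misreport I i t') i (M n I) <=
  utility (misreport I i t') i (M n (misreport I i t')).
Proof.
by move=> /(_ n (misreport I i t') i (approval I i)); rewrite misreportK.
Qed.

Lemma welfare_misreport (R : realType) n (I : instance R n) i t' o :
  welfare (misreport I i t') o = welfare I o +
    ((val t' o.1)%:R - (val (approval I i) o.1)%:R) *
    (1 - `|(position I i)%:num - o.2%:num|).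
Proof.
rewrite /welfare (bigD1 i) //= [in RHS](bigD1 i) //=.
rewrite [X in _ + X](eq_bigr (fun k => utility I k o)); last first.
  by move=> k /negPf ki; rewrite /utility /= ffunE ki.
by rewrite /utility /= ffunE eqxx; ring.
Qed.

Lemma approves_only_subproof (j : facility) :
  [exists k, [ffun k : facility => k == j] k].
Proof. by apply/existsP; exists j; rewrite ffunE. Qed.

Definition approves_only (j : facility) : preference :=
  exist (fun t : {ffun facility -> bool} => [exists k, t k]) _
    (approves_only_subproof j).

Lemma approves_both_subproof : [exists k, [ffun _ : facility => true] k].
Proof. by apply/existsP; exists ord0; rewrite ffunE. Qed.

Definition approves_both : preference :=
  exist (fun t : {ffun facility -> bool} => [exists k, t k]) _
    approves_both_subproof.

Lemma facility_cases (j : facility) : j = ord0 \/ j = ord_max.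
Proof. by case: j => [[|[|//]]] H; [left | right]; apply: val_inj. Qed.

Section TwoCamps.
Variables (R : realType) (pos : facility -> {i01 R}).

Definition camp (i : 'I_4) : facility := if odd i then ord_max else ord0.

Definition camps : instance R 3 :=
  Instance [ffun i => pos (camp i)] [ffun i => approves_only (camp i)].

Let prox (j : facility) (y : {i01 R}) : R := 1 - `|(pos j)%:num - y%:num|.

Lemma camp_inhabited (j : facility) : exists i, camp i = j.
Proof.
by case: (facility_cases j) => ->; [exists 0 | exists 1].
Qed.

Lemma welfare_camps j y : welfare camps (j, y) = 2 * prox j y.
Proof.
rewrite /welfare /utility !big_ord_recr big_ord0 /= !ffunE /camp /= /prox.
by case: (facility_cases j) => -> /=; ring.
Qed.

Lemma welfare_camps_dev i j y :
  welfare (misreport camps i approves_both) (j, y) =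
  2 * prox j y + (j != camp i)%:R * prox (camp i) y.
Proof.
rewrite welfare_misreport welfare_camps /= !ffunE /= /prox.
by case: eqP => _ /=; ring.
Qed.

(** Fixing only the distance keeps the two facilities interchangeable, so one argument covers both
    values of [j]. *)
Lemma camps_ratio_ge (M : mechanism R) :
  `|(pos ord0)%:num - (pos ord_max)%:num| = 3 / 5 -> strategyproof M ->
  ~ (approx_ratio M < (13 / 11)%:E)%E.
Proof.
move=> pos01 spM /approx_ratio_welfare_lt ratioM.
case E : (M 3 camps) => [j y].
have [i ij] := camp_inhabited j.
have [k [kj poskj]] : exists k, k != j /\ `|(pos j)%:num - (pos k)%:num| = 3 / 5.
  by case: (facility_cases j) => ->; [exists ord_max | exists ord0];
    rewrite // distrC.
have prox_self l : prox l (pos l) = 1 by rewrite /prox subrr normr0 subr0.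
have proxjk : prox j (pos k) = 2 / 5 by rewrite /prox poskj; field.
have prox_near : 11 < 13 * prox j y.
  have := ratioM _ camps (j, pos j).
  by rewrite E !welfare_camps prox_self; lra.
have prox_sum z : prox j z + prox k z <= 7 / 5.
  have := ler_distD z%:num (pos j)%:num (pos k)%:num.
  by rewrite poskj (distrC z%:num) /prox; lra.
have := ratioM _ (misreport camps i approves_both) (k, pos k).
(* Agent [i] now approves both facilities, so its utility is [prox j] whichever one opens; hence
   [prox j y <= prox j z]. *)
have := strategyproof_misreport camps i approves_both spM.
rewrite E; case: (M 3 _) => l z.
rewrite !welfare_camps_dev /utility /= !ffunE eqxx /= !ffunE !mul1r.
rewrite ij kj prox_self proxjk -!/(prox _ _).
have [-> | lk] : l = j \/ l = k.
  by case: (facility_cases l) (facility_cases j) (facility_cases k) kj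
    => -> [] -> [] ->; rewrite ?eqxx //; auto.
  have : prox j z <= 1 by rewrite gerBl.
  by rewrite eqxx /=; lra.
(* The welfare [2 * prox k z + prox j z] is at most [14/5 - prox j z], and [prox j z > 11/13]. *)
by have := prox_sum z; rewrite lk kj /=; lra.
Qed.
End TwoCamps.

Lemma i01_ex (R : realType) (x : R) : 0 <= x <= 1 -> exists p : {i01 R}, p%:num = x.
Proof.
move=> x01; have x_itv : Itv.spec (@Itv.num_sem R) (Itv.Real `[0%Z, 1%Z]) x.
  by rewrite /= /Itv.num_sem /= num_real in_itv.
by exists (Itv.mk x_itv).
Qed.

Theorem theorem5p1 (R : realType) :
  ~ exists M : mechanism R,
      strategyproof M /\ (approx_ratio M < (13 / 11)%:E)%E.
Proof.
case=> M [spM ratioM].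
(* At distance [d], the case [l = j] needs [d <= 7/11] and the case [l = k] needs [d >= 8/15]; [3/5]
   meets both. *)
have [[p p0] [q q35]] := (@i01_ex R 0 ltac:(lra), @i01_ex R (3 / 5) ltac:(lra)).
pose pos (j : facility) : {i01 R} := if j == ord0 then p else q.
apply: (@camps_ratio_ge R pos M _ spM ratioM).
by rewrite /pos /= p0 q35 sub0r normrN ger0_norm //; lra.
Qed.
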